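(* Let $n\ge 3$. The set of combinatorial types of $n$-marked rational tropical curves is in bijection to $\bigcup_{d=0}^{n-3}\mathcal{P}_{n,d}^<$. More precisely, for each $d$ the set of all combinatorial types of $n$-marked rational tropical curves with $d$ bounded edges is in bijection to $\mathcal{P}_{n,d}^<$.
   Context: An $n$-marked rational tropical curve is a metric tree with $n$ unbounded edges (leaves), labelled with the numbers $1,\dots,n$, such that all vertices are at least trivalent; the bounded edges have positive lengths. Two such curves have the same combinatorial type if they are equal after forgetting the metric (i.e. the underlying trees are isomorphic by an isomorphism preserving the leaf labels). A moduli Prüfer sequence of order $n$ and length $d$ ($n\ge3$, $d\ge0$) is a sequence $(a_1,\dots,a_{n+d-1})$ with $a_i\in\{n+1,\dots,n+d+1\}$ such that each element of $\{n+1,\dots,n+d+1\}$ occurs at least twice. The set of these sequences is $\mathcal{P}_{n,d}$. Such a sequence is ordered if, after removing all occurrences of each entry but the first, the remaining sequence is sorted ascendingly. The set of ordered sequences is $\mathcal{P}_{n,d}^<$. *)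

(* Defs.v *)
From mathcomp Require Import all_boot all_order all_algebra.
From mathcomp Require Import boolp classical_sets functions reals.

Set Implicit Arguments.
Unset Strict Implicit.
Unset Printing Implicit Defensive.

Import Order.TTheory GRing.Theory Num.Theory.

Section Graph.
Variables (V : finType) (E : {set {set V}}).

Definition adj : rel V := fun x y => [set x; y]%SET \in E.

(* [ucycle adj c] also holds when [c] is empty, or when it runs back and forth
   along a single edge ([size c = 2]); neither is a cycle of the graph. *)
Definition is_tree : Prop :=
  [/\ (0 < #|V|)%N,
      forall A : {set V}, A \in E -> #|A| = 2,
      forall x y : V, connect adj x y
    & forall c : seq V, ucycle adj c -> (size c <= 2)%N].

End Graph.

(* An unbounded edge has a single end vertex and no vertex at infinity, so the
   [n] leaves are given by the function [mark] that sends a label to the vertex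
   where the leaf is attached. The labels 1, ..., n are represented by ['I_n]. *)
Record marked_tree (n : nat) := MarkedTree {
  vertex :> finType;
  edges : {set {set vertex}};
  mark : 'I_n -> vertex;
  marked_treeP : is_tree edges;
  at_least_trivalent : forall v : vertex,
    (3 <= #|[set A in edges | v \in A]%SET| + #|[set i | mark i == v]%SET|)%N
}.

Record tropical_curve (R : realType) (n : nat) := TropicalCurve {
  tree :> marked_tree n;
  edge_length : {A : {set tree} | A \in edges tree} -> R;
  edge_length_gt0 : forall A, (0 < edge_length A)%R
}.

Definition tree_iso (n : nat) (T T' : marked_tree n) : Prop :=
  exists f : T -> T', [/\ bijective f,
    forall x y, adj (edges T') (f x) (f y) = adj (edges T) x y
  & forall i, f (mark T i) = mark T' i].

Definition same_comb_type (R : realType) (n : nat)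
  (C C' : tropical_curve R n) : Prop := tree_iso C C'.

(* A combinatorial type is an equivalence class of [same_comb_type]. The
   classes are written as predicates rather than with [set], because the
   universe of [set] is too low for a type that quantifies over [finType]. *)
Definition comb_type (R : realType) (n : nat) : Type :=
  {T : tropical_curve R n -> Prop | exists C, T = same_comb_type C}.

Definition comb_type_bounded (R : realType) (n d : nat) : Type :=
  {T : comb_type R n | exists2 C, sval T C & #|edges C| = d}.

Definition prufer (n d : nat) : set (seq nat) :=
  [set a | [/\ size a = n + d - 1,
    forall x, x \in a -> n + 1 <= x <= n + d + 1
  & forall x, n + 1 <= x <= n + d + 1 -> 2 <= count_mem x a]]%N%classic.

(* [undup] keeps the last occurrence of each entry, hence the two reversals. *)
Definition first_occurrences (a : seq nat) : seq nat := rev (undup (rev a)).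

Definition ordered_prufer (n d : nat) : set (seq nat) :=
  [set a | prufer n d a /\ sorted leq (first_occurrences a)]%classic.

(* Main.v *)
Require Import Defs.
From mathcomp Require Import all_boot all_order all_algebra.
From mathcomp Require Import boolp classical_sets functions reals.

(** Root an [n]-marked tree at the vertex [r] that carries the last mark. The
tree is then a parent map [p]. List the vertices other than [r] in some order
[t], and write the word consisting of the parents of the entries of [t]
followed by the vertices that carry the first [n - 1] marks. Every edge and
every mark at a vertex accounts for one occurrence of it in this word, except
for the edge to its parent (or the last mark, for the root); so a vertex
occurs once less than its valence (valence_count). If vertices are named by
their rank in [r :: t], being at least trivalent thus says that the word is a
moduli Prüfer sequence, of length [d + (n - 1)] over [d + 1] symbols, and the
sequence is ordered exactly if vertices first occur in it in the order
[r :: t]; such a [t] is called canonical.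

The theorem rests on two facts.

Every rooted tree has exactly one canonical enumeration (canonical_exists,
canonical_unique). It is built from its end: once a final segment is known,
the first occurrence of every vertex all of whose children lie in that segment
is determined, counted from the end of the word, and among the candidates not
yet listed the next one must be the one that first occurs latest.

Every ordered sequence comes from a tree (decode). The sequence prescribes a
parent for each vertex, and the only question is whether following parents
leads to the root. It does: first occurrences increase with the rank, so,
counting from 0, the vertex of rank [k] does not occur before position [k],
while the parent of the vertex of rank [k] stands at position [k - 1]; hence
parents have smaller rank than their children (canonical_parent).

So decoding is injective (decode_inj: an isomorphism carries canonical
enumerations to canonical enumerations and parent words to parent words) and
meets every isomorphism class (decode_surj), for each number [d] of bounded
edges. For the union over [d], the number of edges of the tree decoded from a
sequence is fixed by its length, and it is at most [n - 3] because each of the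
[d + 1] symbols occurs at least twice in a word of length [n + d - 1]. *)

Set Implicit Arguments.
Unset Strict Implicit.
Unset Printing Implicit Defensive.

(** * Canonical enumerations of rooted trees *)

Section CanonicalEnumeration.
Variables (V : finType) (r : V) (p : V -> V) (leaves : seq V).

(** Equivalently, every vertex reaches [r] by following [p]; the rank function
is what inductions along parents need. *)
Definition rooted := exists rk : V -> nat, forall x, x != r -> rk (p x) < rk x.

(** The entries of [leaves] are the parents of the leaves other than the one
whose end vertex is the root. *)
Definition parent_word (t : seq V) : seq V := map p t ++ leaves.

Definition canonical (t : seq V) : Prop :=
  [/\ uniq t, t =i predC1 r
    & forall u v, index u (r :: t) < index v (r :: t) ->
        index u (parent_word t) < index v (parent_word t)].

(** Strictly increasing maps on the natural numbers are at least the
identity. *)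
Lemma canonical_index_leq t v : canonical t ->
  index v (r :: t) <= index v (parent_word t).
Proof.
move=> [t_uniq t_mem mono].
have s_uniq : uniq (r :: t) by rewrite /= t_uniq t_mem !inE eqxx.
have s_mem x : x \in r :: t by rewrite inE t_mem !inE orbN.
have: index v (r :: t) < size (r :: t) by rewrite index_mem.
move: {-1}(index v _) (erefl (index v (r :: t))) => i.
elim: i v => // i IH v iv lti.
have iw : index (nth r (r :: t) i) (r :: t) = i by rewrite index_uniq // ltnW.
have lt_iv : index (nth r (r :: t) i) (r :: t) < index v (r :: t) by rewrite iw iv.
exact: leq_ltn_trans (IH _ iw (ltnW lti)) (mono _ _ lt_iv).
Qed.

(** The parent of the vertex of rank [k] stands at position [k - 1] of the word,
which by [canonical_index_leq] is too early for a vertex of rank [k] or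
more. *)
Lemma canonical_parent t w : canonical t -> w != r ->
  index (p w) (r :: t) < index w (r :: t).
Proof.
move=> can_t wr; apply: leq_ltn_trans (canonical_index_leq (p w) can_t) _.
have [_ t_mem _] := can_t.
have wt : w \in t by rewrite t_mem.
rewrite /= eq_sym (negPf wr) ltnS /parent_word index_cat.
have pwt : p w \in map p t by rewrite map_f.
rewrite pwt leqNgt; apply/negP => /(before_find r)/=.
rewrite (nth_map r) ?index_mem // nth_index // /= eqxx //.
Qed.

Lemma canonical_rooted t : canonical t -> rooted.
Proof. by move=> can_t; exists (index^~ (r :: t)) => x; apply: canonical_parent. Qed.

(** The reason for uniqueness. Both [u] and [v] have all their children in the
common end [s], since children have larger rank; so their first occurrences
already lie in [parent_word s], and in the first enumeration [v], which comes
before [u], occurs first. Exchanging the two enumerations gives the opposite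
inequality. *)
Lemma canonical_last_choice t1 t2 y1 y2 u v s : canonical t1 -> canonical t2 ->
    t1 = rcons y1 u ++ s -> t2 = rcons y2 v ++ s -> u != v ->
  index v (parent_word s) < index u (parent_word s).
Proof.
move=> can1 can2 e1 e2 uv.
have [uniq1 mem1 mono1] := can1; have [uniq2 mem2 mono2] := can2.
have [ut1 vt2] : u \in t1 /\ v \in t2.
  by rewrite e1 e2 !mem_cat !mem_rcons !inE !eqxx.
have [ur vr] : u != r /\ v != r by move: ut1 vt2; rewrite mem1 mem2 !inE.
have [us vs] : u \notin s /\ v \notin s.
  move: uniq1 uniq2; rewrite e1 e2 !cat_uniq => /and3P[_ h1 _] /and3P[_ h2 _].
  by split; [apply: contra h1|apply: contra h2] => h; apply/hasP;
     [exists u|exists v]; rewrite ?mem_rcons ?inE ?eqxx.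
have indexE t w : w != r -> index w (r :: t) = (index w t).+1.
  by move=> wr; rewrite /= eq_sym (negPf wr).
have not_parent t y x w : canonical t -> t = rcons y x ++ s -> x \notin s ->
    w \in rcons y x -> x != p w.
  move=> can e xs wy; apply: contraTneq isT => xw.
  have wr : w != r by have [_ tm _] := can; rewrite -[w != r]tm e mem_cat wy.
  have xr : x != r.
    by have [_ tm _] := can; rewrite -[x != r]tm e mem_cat mem_rcons mem_head.
  have := canonical_parent can wr.
  rewrite -xw !indexE // ltnS ltnNge e !index_cat wy mem_rcons mem_head.
  have yx_uniq : uniq (rcons y x).
    by case: can; rewrite e cat_uniq => /and3P[].
  rewrite -{2}cats1 index_cat; case: ifP => [xy|_].
    by move: yx_uniq; rewrite rcons_uniq xy.
  by rewrite /= eqxx addn0; move: wy; rewrite -index_mem size_rcons ltnS => ->.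
have vt1 : v \in t1 by rewrite mem1.
have lt_vu : index v (r :: t1) < index u (r :: t1).
  have uy : u \in rcons y1 u by rewrite mem_rcons mem_head.
  rewrite !indexE // ltnS e1 !index_cat uy.
  move: vt1; rewrite e1 mem_cat (negPf vs) orbF => vy.
  rewrite vy; move: vy; rewrite mem_rcons inE eq_sym (negPf uv) /= => vy.
  rewrite -cats1 !index_cat vy; case: ifP => [uy1|_].
    by case/negP: us; move: uniq1; rewrite e1 cat_uniq rcons_uniq uy1.
  by rewrite /= eqxx addn0 index_mem.
have uw : u \notin map p (rcons y1 u).
  apply/mapP => -[w wy uE].
  by move: (not_parent _ _ _ _ can1 e1 us wy); rewrite -uE eqxx.
have vw : v \notin map p (rcons y1 u).
  apply/mapP => -[w wy vE].
  have ws : w \notin s.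
    move: uniq1; rewrite e1 cat_uniq => /and3P[_ /hasPn h _].
    by apply/negP => /h/negP.
  have: w \in t2 by rewrite mem2 -mem1 e1 mem_cat wy.
  rewrite e2 mem_cat (negPf ws) orbF.
  move=> /(not_parent _ _ _ _ can2 e2 vs); by rewrite -vE eqxx.
have := mono1 _ _ lt_vu.
rewrite e1 /parent_word map_cat -catA.
rewrite (index_cat v) (negPf vw) (index_cat u) (negPf uw).
by rewrite ltn_add2l.
Qed.

Lemma canonical_unique t1 t2 : canonical t1 -> canonical t2 -> t1 = t2.
Proof.
move=> can1 can2.
have eq_size : size t1 = size t2.
  have [[uniq1 mem1 _] [uniq2 mem2 _]] := (can1, can2).
  by apply/perm_size/uniq_perm => // x; rewrite mem1 mem2.
suff common_suffix y1 y2 s : t1 = y1 ++ s -> t2 = y2 ++ s ->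
    size y1 = size y2 -> y1 = y2.
  by apply: (common_suffix _ _ [::]); rewrite ?cats0.
elim/last_ind: y1 y2 s => [|y1 u IH] y2 s; first by case: y2.
case/lastP: y2 => [|y2 v]; first by rewrite size_rcons.
rewrite !size_rcons => e1 e2 [eq_y]; have uv : u = v.
  apply: contraTeq isT => uv.
  have lt_vu := canonical_last_choice can1 can2 e1 e2 uv.
  have := canonical_last_choice can2 can1 e2 e1; rewrite eq_sym uv => /(_ isT).
  by move/(ltn_trans lt_vu); rewrite ltnn.
by rewrite uv (IH y2 (v :: s)) // -cat_rcons // -uv.
Qed.

Definition complete_children (s : seq V) (c : V) :=
  [forall w, (w != r) && (p w == c) ==> (w \in s)].

(** The invariant of the construction from the end. Its last clause is the one
that makes the greedy choice work: every vertex that could be put in front of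
[s] first occurs before all vertices of [s]. *)
Definition greedy (s : seq V) : Prop :=
  [/\ uniq s, r \notin s, {in s, forall c, complete_children s c},
      {in s &, forall u v, index u s < index v s ->
         index u (parent_word s) < index v (parent_word s)}
    & forall c u, c \notin s -> complete_children s c -> u \in s ->
        index c (parent_word s) < index u (parent_word s)].

Lemma complete_childrenP s c :
  reflect (forall w, w != r -> p w = c -> w \in s) (complete_children s c).
Proof.
apply: (iffP forallP) => [h w wr pw|h w].
  by have := h w; rewrite wr pw eqxx.
by apply/implyP => /andP[wr /eqP]; apply: h.
Qed.

Hypothesis rootedP : rooted.
Hypothesis has_child : forall v, v \in leaves \/ exists2 w, w != r & p w = v.

(** By the third clause of [greedy], [s] is closed under taking children, so it
contains everything below the children of the root. *)
Lemma greedy_root s v : greedy s -> complete_children s r -> v != r -> v \in s.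
Proof.
move=> [_ _ closed _ _] /complete_childrenP root_s; have [rk lt_rk] := rootedP.
have [n] := ubnP (rk v); elim: n v => // n IH v; rewrite ltnS => le_n vr.
have [pv|pvr] := eqVneq (p v) r; first exact: root_s.
have /complete_childrenP := closed _ (IH _ (leq_trans (lt_rk v vr) le_n) pvr).
exact.
Qed.

(** Put in front the available vertex that first occurs latest. Apart from the
vertices that were candidates before, only [p v] can become a candidate, and it
is the first letter of the new word. *)
Lemma greedy_extend s : greedy s -> size s < #|V|.-1 ->
  exists v, greedy (v :: s).
Proof.
move=> gs lt_s; have [s_uniq rs closed mono cand] := gs.
have [rk lt_rk] := rootedP.
(* A vertex of maximal rank outside [s] has all its children in [s], so it is
   available. *)
have [x /andP[xs xr]] : exists x, (x \notin s) && (x != r).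
  apply/existsP; apply: contraLR lt_s; rewrite negb_exists -leqNgt => /forallP h.
  rewrite -(cardC1 r) -(card_uniqP s_uniq).
  apply/subset_leq_card/fintype.subsetP => x xr.
  by have := h x; rewrite negb_and negbK [x != r]xr orbF.
pose avail c := [&& c \notin s, c != r & complete_children s c].
have [v0 v0P] : exists v, avail v.
  case: (@arg_maxnP V x (fun c => (c \notin s) && (c != r)) rk); first by rewrite xs.
  move=> c /andP[cs cr] c_max; exists c; rewrite /avail cs cr /=.
  apply/complete_childrenP => w wr pw; apply: contraTT isT => ws.
  by have := c_max w; rewrite ws wr -pw => /(_ isT); rewrite /= leqNgt lt_rk.
case: (@arg_maxnP V v0 avail (index^~ (parent_word s)) v0P).
move=> v /and3P[vs vr v_compl] v_max; exists v.
have pv_s : p v \notin v :: s.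
  rewrite inE negb_or; apply/andP; split.
    by apply: contraTneq (lt_rk v vr) => ->; rewrite ltnn.
  by apply: contra vs => /closed/complete_childrenP; apply.
have pv_neq c : c \in v :: s -> (p v == c) = false.
  by move=> cs; apply: contraNF pv_s => /eqP->.
have v_lt u : u \in s -> index v (parent_word s) < index u (parent_word s).
  exact: cand.
have compl_word c : complete_children s c -> c \in parent_word s.
  move=> /complete_childrenP c_compl; rewrite mem_cat.
  have [->|[w wr pw]] := has_child c; first by rewrite orbT.
  by rewrite -pw map_f ?c_compl.
have grow c : complete_children s c -> complete_children (v :: s) c.
  move=> /complete_childrenP h; apply/complete_childrenP => w wr pw.
  by rewrite inE h ?orbT.
split; first by rewrite /= vs.
- by rewrite inE eq_sym (negPf vr).
- by move=> c; rewrite inE => /predU1P[->|/closed]; apply: grow.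
- move=> a b ain bin; rewrite /= !pv_neq // ltnS.
  move: ain bin; rewrite !inE ![_ == v]eq_sym.
  have [<-|_] /= := eqVneq v a; have [<-|_] //= := eqVneq v b => ain bin.
    by move=> _; apply: v_lt.
  exact: mono.
move=> c u; rewrite inE negb_or => /andP[cv cs] /complete_childrenP c_compl uin.
rewrite /= (pv_neq u) //; have [//|pvc] := eqVneq (p v) c; rewrite ltnS.
have c_s : complete_children s c.
  apply/complete_childrenP => w wr pw; have := c_compl w wr pw.
  by rewrite inE => /predU1P[wv|//]; rewrite -pw wv eqxx in pvc.
have lt_cv : index c (parent_word s) < index v (parent_word s).
  have cr : c != r.
    by apply: contraNneq vs => cr; apply: greedy_root gs _ vr; rewrite -cr.
  have le_cv : index c (parent_word s) <= index v (parent_word s).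
    by apply: v_max; rewrite /avail cs cr.
  rewrite ltn_neqAle le_cv andbT.
  by apply: contra cv => /eqP /index_inj ->; rewrite ?compl_word.
by move: uin; rewrite inE => /predU1P[->//|/v_lt]; apply: ltn_trans.
Qed.

Lemma canonical_exists : exists t, canonical t.
Proof.
have [t gt size_t] : exists2 t, greedy t & size t = #|V|.-1.
  elim: {-2}(#|V|.-1) (leqnn #|V|.-1) => [|k IH] le_k; first by exists [::].
  have [t gt size_t] := IH (ltnW le_k).
  have [|v gv] := greedy_extend gt; first by rewrite size_t.
  by exists (v :: t); rewrite //= size_t.
have [t_uniq rt closed mono cand] := gt.
have t_mem : t =i predC1 r.
  apply/subset_cardP; first by rewrite (card_uniqP t_uniq) size_t cardC1.
  by apply/fintype.subsetP => x xt; rewrite inE; apply: contraNneq rt => <-.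
have complete_root : complete_children t r.
  by apply/complete_childrenP => w wr _; rewrite t_mem.
exists t; split=> // u v /=.
case: (eqVneq r v) => // rv; have vt : v \in t by rewrite t_mem !inE eq_sym.
case: (eqVneq r u) => [<- _|ru]; first exact: cand.
by apply: mono => //; rewrite t_mem !inE eq_sym.
Qed.

End CanonicalEnumeration.

(** * Trees as parent maps *)

Definition parent_edges (V : finType) (r : V) (p : V -> V) : {set {set V}} :=
  [set [set x; p x] | x in predC1 r].

Lemma set2_inj (T : finType) (a b c d : T) : [set a; b] = [set c; d] ->
  (a = c /\ b = d) \/ (a = d /\ b = c).
Proof.
move=> e; have [/set2P ac /set2P bd] : a \in [set c; d] /\ b \in [set c; d].
  by rewrite -e !inE !eqxx orbT.
have [/set2P ca /set2P db] : c \in [set a; b] /\ d \in [set a; b].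
  by rewrite e !inE !eqxx orbT.
by case: ac bd ca db => ? [] ? [] ? [] ?; subst; auto.
Qed.

Section ParentTree.
Variables (V : finType) (r : V) (p : V -> V).
Hypothesis rootedP : rooted r p.

Lemma parent_edge_inj : {in predC1 r &, injective (fun x => [set x; p x])}.
Proof.
have [rk lt_rk] := rootedP; move=> x y xr yr /set2_inj[[]//|[xy yx]].
by have := lt_rk y yr; have := lt_rk x xr; rewrite yx -xy ltnNge => /negP h /ltnW.
Qed.

Lemma adj_parent x y : adj (parent_edges r p) x y =
  (x != r) && (p x == y) || (y != r) && (p y == x).
Proof.
apply/imsetP/orP => [[z zr /set2_inj[[-> ->]|[-> ->]]]|].
- by left; rewrite eqxx andbT.
- by right; rewrite eqxx andbT.
by case=> /andP[zr /eqP <-]; [exists x|exists y; rewrite // finset.setUC].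
Qed.

Lemma card_parent_edges : #|parent_edges r p| = #|V|.-1.
Proof. by rewrite (card_in_imset parent_edge_inj) cardC1. Qed.

Lemma parent_neq x : x != r -> p x != x.
Proof.
have [rk lt_rk] := rootedP => /lt_rk; apply: contraTneq => ->.
by rewrite ltnn.
Qed.

(** The edges at [v] correspond to their lower ends: the children of [v], and
[v] itself unless it is the root. *)
Lemma card_incident v : #|[set A in parent_edges r p | v \in A]| =
  #|[set w | (w != r) && (p w == v)]| + (v != r).
Proof.
pose D := [set w | (w != r) && (p w == v)].
have -> : [set A in parent_edges r p | v \in A] =
    [set [set x; p x] | x in [set x | (x != r) && ((x == v) || (p x == v))]].
  apply/setP => A; rewrite inE; apply/andP/imsetP.
    move=> [/imsetP[x xr ->]]; rewrite !inE => vx.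
    by exists x; rewrite // inE ![_ == v]eq_sym vx andbT.
  move=> [x]; rewrite inE => /andP[xr vx] ->.
  by split; [apply: imset_f|rewrite !inE ![v == _]eq_sym].
rewrite card_in_imset => [|x y]; last first.
  by rewrite !inE => /andP[xr _] /andP[yr _]; apply: parent_edge_inj.
have -> : nat_of_bool (v != r) = #|[set x | (x != r) && (x == v)]|.
  have [vr|vr] := eqVneq v r.
    by apply/esym/eqP; rewrite cards_eq0; apply/eqP/setP => x;
       rewrite !inE vr andNb.
  by apply/esym/eqP/cards1P; exists v; apply/setP => x; rewrite !inE andbC;
     case: eqVneq => // ->.
rewrite -cardsUI [_ :&: _](_ : _ = finset.set0) ?cards0 ?addn0.
  by apply: eq_card => x; rewrite !inE -andb_orr orbC.
apply/setP => x; rewrite !inE; apply/negP => /andP[/andP[xr /eqP pv] /andP[_ /eqP xv]].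
by have := parent_neq xr; rewrite pv xv eqxx.
Qed.

(** A cycle is impossible: at a vertex of maximal rank in it, both neighbours
along the cycle would be the parent of that vertex. *)
Lemma parent_edges_tree : is_tree (parent_edges r p).
Proof.
have [rk lt_rk] := rootedP.
have adj_sym : symmetric (adj (parent_edges r p)).
  by move=> x y; rewrite !adj_parent orbC.
split.
- by apply/card_gt0P; exists r.
- by move=> _ /imsetP[x xr ->]; rewrite cards2 eq_sym parent_neq.
- have to_root x : connect (adj (parent_edges r p)) x r.
    have [n] := ubnP (rk x); elim: n x => // n IH x; rewrite ltnS => le_n.
    have [->//|xr] := eqVneq x r.
    apply: connect_trans (IH _ (leq_trans (lt_rk x xr) le_n)).
    by apply: connect1; rewrite adj_parent xr eqxx.
  move=> x y; apply: connect_trans (to_root x) _.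
  by rewrite (sym_connect_sym adj_sym).
move=> c /andP[c_cycle c_uniq]; case: c c_cycle c_uniq => // c0 c' c_cycle c_uniq.
case: (@arg_maxnP V c0 (mem (c0 :: c')) rk (mem_head _ _)) => x x_c x_max.
have parent_of y : y \in c0 :: c' -> adj (parent_edges r p) x y -> p x = y.
  move=> /x_max le_yx; rewrite adj_parent => /orP[/andP[_ /eqP//]|/andP[yr /eqP pyx]].
  by have := lt_rk y yr; rewrite pyx ltnNge [_ <= _]le_yx.
(* Turn the cycle so that it starts at [x]; its second and its last vertex are
   then the two neighbours of [x]. *)
have [i q rotE] := rot_to x_c.
rewrite -(size_rot i) rotE leqNgt; apply/negP.
move: c_cycle c_uniq; rewrite -(rot_cycle i) -(rot_uniq i) rotE.
have q_sub : {subset q <= c0 :: c'}.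
  by move=> y yq; rewrite -(mem_rot i) rotE inE yq orbT.
case: q q_sub {rotE} => // y q; case/lastP: q => // q z q_sub.
rewrite /= rcons_path last_rcons => /and3P[xy _ zx] /and3P[_ yq _] _.
have yz : y = z.
  rewrite -(parent_of y) ?q_sub ?mem_head //; apply: parent_of.
    by apply: q_sub; rewrite inE mem_rcons mem_head orbT.
  by rewrite adj_sym.
by case/negP: yq; rewrite yz mem_rcons mem_head.
Qed.

End ParentTree.

(** The parent of [v] is a neighbour at smaller distance from [r]. An edge
[[set x; y]] that is not of the form [[set v; p v]] would close a cycle with a
path from [x] to [y] in the tree of parent edges. *)
Lemma tree_parent (V : finType) (E : {set {set V}}) (r : V) : is_tree E ->
  exists p, rooted r p /\ E = parent_edges r p.
Proof.
move=> [_ E2 E_conn E_acyclic].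
have adj_sym : symmetric (adj E) by move=> x y; rewrite /adj finset.setUC.
pose reach v k := `[< exists2 q, path (adj E) r q & last r q = v /\ size q = k >].
have reach_ex v : exists k, reach v k.
  have /connectP[q rq vE] := E_conn r v.
  by exists (size q); apply/asboolP; exists q.
pose dist v := ex_minn (reach_ex v).
have dist_reach v : reach v (dist v) by rewrite /dist; case: ex_minnP.
have dist_min v k : reach v k -> dist v <= k.
  by rewrite /dist; case: ex_minnP => j _; apply.
have closer v : exists w, (v != r) ==> adj E v w && (dist w < dist v).
  have [->|vr] := eqVneq v r; first by exists r.
  have /asboolP[q rq [qv <-]] := dist_reach v.
  case/lastP: q rq qv => [_ /eqP|q w]; first by rewrite eq_sym (negPf vr).
  rewrite last_rcons size_rcons rcons_path => /andP[rq qw] wv.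
  exists (last r q); rewrite /= adj_sym -wv qw ltnS dist_min //.
  by apply/asboolP; exists q.
pose p v := xchoose (closer v).
have pP v : v != r -> adj E v (p v) && (dist (p v) < dist v).
  by move=> vr; apply: implyP vr; apply: (xchooseP (closer v)).
have rootedP : rooted r p by exists dist => x /pP/andP[].
have sub_E : {subset parent_edges r p <= E}.
  by move=> _ /imsetP[x xr ->]; case/andP: (pP x xr).
exists p; split=> //; apply/eqP; rewrite finset.eqEsubset; apply/andP.
split; last exact/fintype.subsetP.
apply/fintype.subsetP => A AE; have /eqP/cards2P[x [y [xy eA]]] := E2 A AE.
rewrite {}eA in AE *; apply: contraT => xyF.
have [_ _ /(_ x y)/connectP[q0 xq0]] := parent_edges_tree rootedP.
case/shortenP: xq0 => q xq q_uniq _ yE _.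
have: ucycle (adj E) (x :: q).
  rewrite /ucycle q_uniq andbT /= rcons_path -yE.
  rewrite (sub_path _ xq) => [|u v /sub_E//].
  by rewrite /= adj_sym.
move/E_acyclic; case: q xq yE {q_uniq} => [|z [|z' q]] //=.
  by move=> _ yx; rewrite yx eqxx in xy.
by rewrite /adj andbT => xz yz; rewrite yz xz in xyF.
Qed.

(** By induction from the root: [f x] and [f (p x)] are adjacent, and [f x]
cannot be the parent of [f (p x)], which is either the root or already known to
have the parent [f (p (p x))]. *)
Lemma parent_morph (V V' : finType) (r : V) (r' : V') p p' (f : V -> V') :
    rooted r p -> rooted r' p' -> injective f ->
    (forall x y,
       adj (parent_edges r' p') (f x) (f y) = adj (parent_edges r p) x y) ->
  f r = r' -> forall x, x != r -> f (p x) = p' (f x).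
Proof.
move=> root root' f_inj f_adj fr x; have [rk lt_rk] := root.
have [n] := ubnP (rk x); elim: n x => // n IH x; rewrite ltnS => le_n xr.
have: adj (parent_edges r' p') (f x) (f (p x)).
  by rewrite f_adj adj_parent xr eqxx.
rewrite adj_parent -fr !(inj_eq f_inj) => /orP[/andP[_ /eqP//]|].
move=> /andP[pr /eqP e]; have := IH (p x) (leq_trans (lt_rk x xr) le_n) pr.
rewrite e => /f_inj ppx.
by have := ltn_trans (lt_rk _ pr) (lt_rk _ xr); rewrite ppx ltnn.
Qed.

(** * Ordered sequences and valences *)

Lemma first_occurrences_cons x a :
  first_occurrences (x :: a) = x :: [seq y <- first_occurrences a | y != x].
Proof. by rewrite /first_occurrences rev_cons undup_rcons rev_rcons filter_rev. Qed.

Lemma mem_first_occurrences a : first_occurrences a =i a.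
Proof. by move=> x; rewrite mem_rev mem_undup mem_rev. Qed.

Lemma first_occurrences_pairwise a :
  pairwise (relpre (index^~ a) ltn) (first_occurrences a).
Proof.
elim: a => // x a IH; rewrite first_occurrences_cons pairwise_cons.
apply/andP; split.
  by apply/allP => y; rewrite mem_filter /= eqxx eq_sym => /andP[/negPf->].
move: IH => /(pairwise_filter (predC1 x)).
apply: (@sub_in_pairwise _ (predC1 x)); last exact: filter_all.
by move=> y z; rewrite !inE /= ![_ == x]eq_sym => /negPf-> /negPf->.
Qed.

Lemma sorted_first_occurrencesP a : sorted leq (first_occurrences a) <->
  {in a &, forall x y, x < y -> index x a < index y a}.
Proof.
have trans_a : transitive (relpre (index^~ a) ltn).
  by move=> y x z; apply: ltn_trans.
have := first_occurrences_pairwise a; rewrite -(sorted_pairwise trans_a) => sort_a.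
split=> [sort_leq x y xa ya lt_xy|mono].
  have [xs ys] : x \in first_occurrences a /\ y \in first_occurrences a.
    by rewrite !mem_first_occurrences.
  case: (ltngtP (index x (first_occurrences a)) (index y (first_occurrences a))).
  - exact: (sorted_ltn_index trans_a sort_a _ _ xs ys).
  - move=> /(sorted_ltn_index leq_trans sort_leq _ _ ys xs).
    by rewrite leqNgt lt_xy.
  - by move=> /(index_inj 0 xs ys) xy; rewrite xy ltnn in lt_xy.
apply: (@sub_in_sorted _ (mem a)) sort_a.
  move=> x y xa ya /= lt_ixy; rewrite leqNgt; apply/negP => /(mono _ _ ya xa).
  by move/(ltn_trans lt_ixy); rewrite ltnn.
by apply/allP => x; rewrite mem_first_occurrences.
Qed.

Lemma size_sum_count (T : finType) (s : seq T) :
  size s = \sum_(v : T) count_mem v s.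
Proof.
elim: s => [|x s IH] /=; first by rewrite big1.
rewrite big_split -IH /= (bigD1 x) //= eqxx big1 // => v.
by rewrite eq_sym => /negPf->.
Qed.

(** All marks but the last, which marks the root. *)
Definition lower_marks (V : Type) (m : nat) (mark : 'I_m.+1 -> V) : seq V :=
  [seq mark (widen_ord (leqnSn m) i) | i <- enum 'I_m].

Lemma size_lower_marks (V : Type) m (mark : 'I_m.+1 -> V) :
  size (lower_marks mark) = m.
Proof. by rewrite size_map size_enum_ord. Qed.

(** With the root as default value, position [m] yields the last mark too. *)
Lemma nth_lower_marks (V : Type) m (mark : 'I_m.+1 -> V) (i : 'I_m.+1) :
  nth (mark ord_max) (lower_marks mark) i = mark i.
Proof.
have [lt_im|le_mi] := ltnP i m.
  rewrite (nth_map (Ordinal lt_im)) ?size_enum_ord //; congr (mark _).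
  by apply/val_inj; rewrite /= nth_enum_ord.
rewrite nth_default ?size_lower_marks //; congr (mark _).
by apply/val_inj/eqP; rewrite eqn_leq le_mi -ltnS ltn_ord.
Qed.

(** The one edge or mark at [v] that the word does not count is the edge to the
parent if [v] is not the root, and the last mark if it is. *)
Lemma valence_count (V : finType) (p : V -> V) m (mark : 'I_m.+1 -> V) t v :
    let r := mark ord_max in
    rooted r p -> uniq t -> t =i predC1 r ->
  #|[set A in parent_edges r p | v \in A]| + #|[set i | mark i == v]| =
    (count_mem v (parent_word p (lower_marks mark) t)).+1.
Proof.
move=> r root t_uniq t_mem; rewrite (card_incident root) count_cat.
have -> : #|[set w | (w != r) && (p w == v)]| = count_mem v (map p t).
  rewrite count_map -size_filter -(card_uniqP (filter_uniq _ t_uniq)).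
  by apply: eq_card => w; rewrite inE mem_filter t_mem inE andbC.
have -> : #|[set i | mark i == v]| = count_mem v (lower_marks mark) + (r == v).
  rewrite -sum1dep_card big_mkcond big_ord_recr /= -/r count_map -sum1_count.
  by rewrite big_enum_cond /= [in RHS]big_mkcond; congr (_ + _).
by rewrite addnACA [r == v]eq_sym; case: (v == r); rewrite ?addn0 ?addn1.
Qed.

(** * From ordered sequences to trees *)

Section Decode.
Variables (m d : nat) (a : seq nat).
Hypothesis aP : ordered_prufer m.+1 d a.

(** The symbols [n + 1, ..., n + d + 1], with [n = m.+1], become the vertices
[0, ..., d]. *)
Definition code_word : seq 'I_d.+1 := [seq inord (x - m.+2) | x <- a].

(** The vertex [j] has position [j.-1] in the enumeration [1, ..., d]. *)
Definition code_parent (j : 'I_d.+1) : 'I_d.+1 := nth ord0 code_word j.-1.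

(** For the last mark the position is past the end of the word, and the default
value is the root. *)
Definition code_mark (i : 'I_m.+1) : 'I_d.+1 := nth ord0 code_word (d + i).

Definition code_inner : seq 'I_d.+1 := [seq lift ord0 i | i <- enum 'I_d].

(** The range condition on the entries makes the shift reversible. *)
Lemma code_wordK : a = [seq m.+2 + val v | v <- code_word].
Proof.
have [[_ a_range _] _] := aP; rewrite -map_comp map_id_in // => x xa /=.
have /andP[] := a_range x xa; rewrite addn1 => le1 le2.
have lt_x : x - m.+2 < d.+1 by rewrite ltnS leq_subLR (leq_trans le2) // addn1.
by rewrite inordK ?subnKC.
Qed.

Lemma size_code_word : size code_word = d + m.
Proof.
by have [[a_size _ _] _] := aP; rewrite size_map a_size addSn subn1 addnC.
Qed.

Lemma count_code_word v : 2 <= count_mem v code_word.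
Proof.
have [[_ _ a_count] _] := aP.
have -> : count_mem v code_word = count_mem (m.+2 + val v) a.
  rewrite [in RHS]code_wordK [RHS]count_map; apply: eq_count => w /=.
  by rewrite eqn_add2l.
apply: a_count; rewrite addn1 leq_addr addn1 !addSn !ltnS leq_add2l.
by rewrite -ltnS ltn_ord.
Qed.

Lemma code_mark_max : code_mark ord_max = ord0.
Proof. by rewrite /code_mark nth_default // size_code_word. Qed.

Lemma size_code_inner : size code_inner = d.
Proof. by rewrite size_map size_enum_ord. Qed.

Lemma parent_code_word :
  parent_word code_parent (lower_marks code_mark) code_inner = code_word.
Proof.
rewrite -[RHS](cat_take_drop d); congr (_ ++ _); apply: (@eq_from_nth _ ord0).
- rewrite size_map size_code_inner size_take_min size_code_word.
  by rewrite (minn_idPl (leq_addr _ _)).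
- move=> i; rewrite size_map size_code_inner => lt_id.
  rewrite (nth_map ord0) ?size_code_inner // nth_take //.
  rewrite (nth_map (Ordinal lt_id)) ?size_enum_ord // /code_parent.
  by rewrite lift0 /= nth_enum_ord.
- by rewrite size_lower_marks size_drop size_code_word addKn.
move=> i; rewrite size_lower_marks => lt_im.
have := nth_lower_marks code_mark (widen_ord (leqnSn m) (Ordinal lt_im)).
by rewrite code_mark_max nth_drop.
Qed.

(** This is what being ordered means, since the enumeration lists the vertices
in their natural order. *)
Lemma code_inner_canonical :
  canonical ord0 code_parent (lower_marks code_mark) code_inner.
Proof.
have innerE : ord0 :: code_inner = enum 'I_d.+1 by rewrite enum_ordSl.
split.
- by rewrite map_inj_uniq ?enum_uniq //; apply: lift_inj.
- have := enum_uniq 'I_d.+1; rewrite -innerE /= => /andP[n0 _] j.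
  have := mem_enum 'I_d.+1 j; rewrite -innerE !inE.
  by case: eqVneq => // -> _; apply: negPf.
have [_ /sorted_first_occurrencesP mono] := aP.
have inj_shift : injective (fun v : 'I_d.+1 => m.+2 + val v).
  by move=> u v /addnI/val_inj.
have mem_a (v : 'I_d.+1) : m.+2 + val v \in a.
  rewrite code_wordK; apply/mapP; exists v => //.
  by rewrite -has_pred1 has_count (leq_trans _ (count_code_word v)).
move=> u v; rewrite parent_code_word innerE !index_enum_ord => lt_uv.
have := mono _ _ (mem_a u) (mem_a v); rewrite ltn_add2l => /(_ lt_uv).
by rewrite code_wordK !(index_map inj_shift).
Qed.

Lemma code_rooted : rooted ord0 code_parent.
Proof. exact: canonical_rooted code_inner_canonical. Qed.

Lemma code_trivalent (v : 'I_d.+1) :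
  3 <= #|[set A in parent_edges ord0 code_parent | v \in A]|
       + #|[set i | code_mark i == v]|.
Proof.
have [inner_uniq inner_mem _] := code_inner_canonical.
move: code_rooted inner_mem; rewrite -code_mark_max => root inner_mem.
rewrite (valence_count _ root inner_uniq inner_mem) parent_code_word ltnS.
exact: count_code_word.
Qed.

Definition decode : marked_tree m.+1 :=
  MarkedTree (parent_edges_tree code_rooted) code_trivalent.

Lemma card_edges_decode : #|edges decode| = d.
Proof. by rewrite (card_parent_edges code_rooted) card_ord. Qed.

Lemma ordered_prufer_bound : d <= m.+1 - 3.
Proof.
have: \sum_(v : 'I_d.+1) 2 <= size code_word.
  by rewrite size_sum_count; apply: leq_sum => v _; apply: count_code_word.
rewrite sum_nat_const card_ord size_code_word muln2 -addnn addSnnS leq_add2l => dm.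
by rewrite subSS leq_subRL ?add2n // (leq_trans _ dm).
Qed.

End Decode.

(** * Decoding is a bijection onto isomorphism classes *)

Lemma tree_iso_refl n (T : marked_tree n) : tree_iso T T.
Proof. by exists id; split=> //; exists id. Qed.

Lemma tree_iso_sym n (T T' : marked_tree n) : tree_iso T T' -> tree_iso T' T.
Proof.
move=> [f [[g fK gK] f_adj f_mark]]; exists g; split; first by exists f.
  by move=> x y; rewrite -f_adj !gK.
by move=> i; rewrite -f_mark fK.
Qed.

Lemma tree_iso_trans n (T T' T'' : marked_tree n) :
  tree_iso T T' -> tree_iso T' T'' -> tree_iso T T''.
Proof.
move=> [f [f_bij f_adj f_mark]] [g [g_bij g_adj g_mark]]; exists (g \o f).
split; first exact: bij_comp.
  by move=> x y; rewrite /= g_adj f_adj.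
by move=> i; rewrite /= f_mark g_mark.
Qed.

(** The number of edges is determined by the length of the sequence. *)
Lemma decode_irrelevant m d d' a (aP : ordered_prufer m.+1 d a)
  (aP' : ordered_prufer m.+1 d' a) : tree_iso (decode aP) (decode aP').
Proof.
have dd' : d = d'.
  have [[[sz _ _] _] [[sz' _ _] _]] := (aP, aP').
  by apply: (@addnI m); move: sz; rewrite sz' !addSn !subn1 /= => ->.
by subst d'; rewrite (Prop_irrelevance aP aP'); apply: tree_iso_refl.
Qed.

(** The image under an isomorphism of the canonical enumeration [1, ..., d] is
canonical, so it is again [1, ..., d] by uniqueness. The isomorphism is
therefore the identity, and both trees have the same word. *)
Lemma decode_inj m d d' a b (aP : ordered_prufer m.+1 d a)
  (bP : ordered_prufer m.+1 d' b) : tree_iso (decode aP) (decode bP) -> a = b.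
Proof.
move=> [f [f_bij f_adj f_mark]].
have dd' : d = d' by move: (bij_eq_card f_bij); rewrite !card_ord => -[].
subst d'; have f_inj := bij_inj f_bij.
have canA := code_inner_canonical aP; have canB := code_inner_canonical bP.
have f0 : f ord0 = ord0.
  by have := f_mark ord_max; rewrite /= !code_mark_max.
have f_parent := parent_morph (code_rooted aP) (code_rooted bP) f_inj f_adj f0.
have [t_uniq t_mem mono] := canA.
set t := code_inner d in canA canB t_uniq t_mem mono.
have word_f :
  parent_word (code_parent m b) (lower_marks (@code_mark m d b)) (map f t) =
    map f (code_word m d a).
  rewrite -(parent_code_word aP) /parent_word map_cat; congr (_ ++ _).
    rewrite -(map_comp _ f t) -(map_comp f _ t); apply/eq_in_map => x.
    by rewrite t_mem => xr /=; rewrite f_parent.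
  by rewrite -map_comp; apply: eq_map => i; apply/esym/f_mark.
have can_f :
  canonical ord0 (code_parent m b) (lower_marks (@code_mark m d b)) (map f t).
  have [g fK gK] := f_bij.
  split=> [|x|u v]; first by rewrite map_inj_uniq.
    by rewrite -[x]gK mem_map // t_mem !inE -[in RHS]f0 (inj_eq f_inj).
  rewrite word_f -{1 2}f0 -map_cons -[u]gK -[v]gK !index_map //.
  by rewrite -(parent_code_word aP); apply: mono.
have ft := canonical_unique can_f canB.
have f_id : f =1 id.
  move=> x; have [->|xr] := eqVneq x ord0; first exact: f0.
  have: x \in t by rewrite t_mem.
  by move: x {xr}; apply/eq_in_map; rewrite map_id.
rewrite (code_wordK aP) (code_wordK bP); congr map.
rewrite -(parent_code_word bP) -/t -ft word_f.
by rewrite (eq_map f_id) map_id.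
Qed.

(** Name each vertex by its rank in the canonical enumeration of the tree rooted
at its last mark; the sequence is the parent word in these names. *)
Lemma decode_surj m (T : marked_tree m.+1) :
  exists a, exists aP : ordered_prufer m.+1 #|edges T| a, tree_iso T (decode aP).
Proof.
pose r := mark T ord_max; pose L := lower_marks (mark T).
have [p [root edgesE]] := tree_parent r (marked_treeP T).
have card_word t v : uniq t -> t =i predC1 r ->
  2 <= count_mem v (parent_word p L t).
  move=> t_uniq t_mem; have := at_least_trivalent v.
  by rewrite edgesE (valence_count v root t_uniq t_mem).
have [t can_t] : exists t, canonical r p L t.
  apply: canonical_exists => // v.
  have := card_word (enum (predC1 r)) v (enum_uniq _) (mem_enum _).
  move=> /(leq_trans (isT : 0 < 2)); rewrite -has_count has_pred1 mem_cat.
  case/orP => [/mapP[w]|]; last by left.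
  by rewrite mem_enum => wr ->; right; exists w.
have [t_uniq t_mem mono] := can_t.
have s_uniq : uniq (r :: t) by rewrite /= t_uniq t_mem !inE eqxx.
have s_mem x : x \in r :: t by rewrite inE t_mem !inE orbN.
have size_t : size t = #|edges T|.
  rewrite edgesE (card_parent_edges root) -(cardC1 r) -(card_uniqP t_uniq).
  exact: eq_card.
set d := #|edges T| in size_t *.
pose rank v := index v (r :: t).
have rank_inj : injective rank by move=> u v; apply: (index_inj r).
have size_s : size (r :: t) = d.+1 by rewrite /= size_t.
have rank_lt v : rank v < d.+1 by rewrite -size_s index_mem.
pose W := parent_word p L t; pose a := [seq m.+2 + rank v | v <- W].
have code_inj : injective (fun v => m.+2 + rank v) by move=> u v /addnI/rank_inj.
have aP : ordered_prufer m.+1 d a.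
  split; first split.
  - rewrite size_map size_cat size_map size_lower_marks size_t.
    by rewrite addSn subn1 addnC.
  - move=> _ /mapP[v _ ->]; rewrite addn1 leq_addr addn1 !addSn !ltnS leq_add2l.
    by rewrite -ltnS rank_lt.
  - move=> x; rewrite addn1 => /andP[le1 le2].
    have lt_x : x - m.+2 < size (r :: t).
      by rewrite size_s ltnS leq_subLR (leq_trans le2) // addn1 !addSn.
    have -> : x = m.+2 + rank (nth r (r :: t) (x - m.+2)).
      by rewrite /rank index_uniq // subnKC.
    rewrite count_map; apply: leq_trans (card_word t _ t_uniq t_mem) _.
    by apply: sub_count => w /= /eqP->.
  apply/sorted_first_occurrencesP => _ _ /mapP[u _ ->] /mapP[v _ ->].
  by rewrite ltn_add2l !(index_map code_inj); apply: mono.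
exists a; exists aP.
pose f v : 'I_d.+1 := Ordinal (rank_lt v).
have f_inj : injective f by move=> u v /(congr1 val)/rank_inj.
have fr : f r = ord0 by apply/val_inj; rewrite /= /rank /= eqxx.
have nth_f k : nth ord0 (code_word m d a) k = f (nth r W k).
  have -> : code_word m d a = map f W.
    rewrite /code_word -map_comp; apply: eq_map => v; apply/val_inj.
    by rewrite /= addKn inordK.
  have [lt_k|le_k] := ltnP k (size W); first by rewrite (nth_map r).
  by rewrite !nth_default ?size_map.
have f_parent v : v != r -> code_parent m a (f v) = f (p v).
  move=> vr; have vt : v \in t by rewrite t_mem.
  rewrite /code_parent nth_f /= /rank /= eq_sym (negPf vr) /=.
  rewrite nth_cat size_map index_mem vt (nth_map r) ?index_mem //.
  by rewrite nth_index.
exists f; split.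
- apply: inj_card_bij => //; rewrite card_ord -size_s.
  by rewrite -(card_uniqP s_uniq) subset_leq_card //; apply/fintype.subsetP.
- move=> x y; rewrite edgesE !adj_parent -fr !(inj_eq f_inj).
  have [xr|xr] /= := eqVneq x r; have [yr|yr] //= := eqVneq y r;
    by rewrite ?f_parent // ?(inj_eq f_inj).
move=> i; rewrite /= /code_mark nth_f nth_cat size_map size_t ltnNge leq_addr /=.
rewrite addKn.
by congr f; apply/esym/nth_lower_marks.
Qed.

(** * Combinatorial types *)

Lemma comb_type_eq (R : realType) n (C C' : tropical_curve R n) :
  tree_iso C C' -> same_comb_type C = same_comb_type C'.
Proof.
move=> iso; apply: funext => D; apply: propext; split.
  exact: tree_iso_trans (tree_iso_sym iso).
exact: tree_iso_trans iso.
Qed.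

Definition unit_curve (R : realType) n (T : marked_tree n) : tropical_curve R n :=
  @TropicalCurve R n T (fun _ => 1%R) (fun _ => Num.Theory.ltr01).

Lemma inverse_bijection (A B : Type) (g : A -> B) : injective g ->
  (forall b, exists a, g a = b) -> exists f : B -> A, bijective f.
Proof.
move=> g_inj g_surj; exists (fun b => sval (cid (g_surj b))).
exists g => [b|x]; first exact: svalP (cid (g_surj b)).
exact/g_inj/(svalP (cid (g_surj (g x)))).
Qed.

Section CombinatorialTypes.
Variables (R : realType) (m : nat).

Definition decode_type d a (aP : ordered_prufer m.+1 d a) : comb_type R m.+1 :=
  exist _ (same_comb_type (unit_curve R (decode aP))) (ex_intro _ _ erefl).

Lemma decode_type_inj d d' a b (aP : ordered_prufer m.+1 d a)
  (bP : ordered_prufer m.+1 d' b) : decode_type aP = decode_type bP -> a = b.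
Proof.
move=> /(congr1 sval)/= e; apply: (decode_inj (aP := aP) (bP := bP)).
have: same_comb_type (unit_curve R (decode bP)) (unit_curve R (decode bP)).
  exact: tree_iso_refl.
by rewrite -e.
Qed.

Lemma decode_type_eq d a (aP : ordered_prufer m.+1 d a) (T : comb_type R m.+1) C :
  sval T C -> tree_iso C (decode aP) -> decode_type aP = T.
Proof.
case: T => T [D eT] /= TC iso; apply: eq_exist; rewrite eT.
by apply/esym/comb_type_eq; apply: tree_iso_trans iso; rewrite eT in TC.
Qed.

End CombinatorialTypes.

Theorem proposition6p7 (R : realType) (n : nat) (hn : (3 <= n)%N) :
  (exists f : comb_type R n ->
       {a : seq nat |
         (\bigcup_(d in [set d | (d <= n - 3)%N]) ordered_prufer n d)%classic a},
     bijective f)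
  /\ (forall d : nat,
     exists f : comb_type_bounded R n d -> {a : seq nat | ordered_prufer n d a},
     bijective f).
Proof.
case: n hn => // m _; split=> [|d].
  set codes := (\bigcup_(d in _) _)%classic.
  have depth a : codes a -> exists d, ordered_prufer m.+1 d a.
    by case=> d _ aP; exists d.
  pose g (a : {a | codes a}) := decode_type R (svalP (cid (depth _ (svalP a)))).
  apply: (@inverse_bijection _ _ g).
    move=> a b /decode_type_inj.
    by apply: eq_sig_hprop => ? ? ?; apply: Prop_irrelevance.
  move=> T; have [C TC] : exists C, sval T C.
    by case: T => T [C eT]; exists C; rewrite /= eT; apply: tree_iso_refl.
  have [a [aP iso]] := decode_surj C.
  have aU : codes a.
    by exists #|edges C| => //; apply: ordered_prufer_bound aP.
  exists (exist _ a aU); apply: decode_type_eq TC _.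
  exact: tree_iso_trans iso (decode_irrelevant _ _).
pose g (a : {a : seq nat | ordered_prufer m.+1 d a}) : comb_type_bounded R m.+1 d :=
  exist _ (decode_type R (svalP a))
    (ex_intro2 _ _ (unit_curve R (decode (svalP a))) (tree_iso_refl _)
       (card_edges_decode (svalP a))).
apply: (@inverse_bijection _ _ g).
  move=> a b eq_g; have := congr1 (fun T : comb_type_bounded R m.+1 d => sval T) eq_g.
  move/decode_type_inj.
  by apply: eq_sig_hprop => ? ? ?; apply: Prop_irrelevance.
move=> [T [C TC Cd]]; have [a [aP iso]] := decode_surj C.
subst d; exists (exist _ a aP); apply: eq_exist.
apply: decode_type_eq TC _.
exact: tree_iso_trans iso (decode_irrelevant _ _).
Qed.
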